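(* Let $\mathbb{F}$ be a finite field of prime order in which $-1$ is not a square. Furthermore, assume that $\mathcal{I}\left(\alpha,\frac{8(\alpha-3)(\alpha-2)}{9\alpha-6}\right)$ holds. Then the extension constant of the $3$-dimensional paraboloid $\mathcal{P}=\{(\omega,\omega\cdot\omega):\omega\in\mathbb{F}_*^2\}\subset\mathbb{F}_*^3$ satisfies $$\mathcal{R}^{*}\left(2\rightarrow\frac{12-2\alpha}{4-\alpha}+\epsilon\right)\ll 1$$ for all $\epsilon>0$.
   Context: Let $\mathbb{F}$ be a finite field, $e(\cdot)$ a fixed non-principal additive character of $\mathbb{F}$, and $x\cdot\xi=\sum_i x_i\xi_i$. The space $\mathbb{F}^n$ carries counting measure $dx$; $\mathbb{F}_*^n$ denotes its (isomorphic) dual. Norms: $\|f\|_{L^q(\mathbb{F}^n,dx)}=(\sum_{x\in\mathbb{F}^n}|f(x)|^q)^{1/q}$. For nonempty $S\subset\mathbb{F}_*^n$, $d\sigma$ is the measure assigning mass $|S|^{-1}$ to each point of $S$, so $\|g\|_{L^p(S,d\sigma)}=(|S|^{-1}\sum_{\xi\in S}|g(\xi)|^p)^{1/p}$, and $(g\,d\sigma)^\vee(x)=|S|^{-1}\sum_{\xi\in S}g(\xi)e(x\cdot\xi)$ for $x\in\mathbb{F}^n$. For $1\le p,q\le\infty$, $\mathcal{R}^*(p\to q)$ is the best constant such that $\|(g\,d\sigma)^\vee\|_{L^q(\mathbb{F}^n,dx)}\le\mathcal{R}^*(p\to q)\|g\|_{L^p(S,d\sigma)}$ for all $g$ supported on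 $S$. Here $n=3$ and $S=\mathcal{P}$. The notation $\ll 1$ means bounded independently of the size of the field. For a set $P$ of points and a set $L$ of lines in $\mathbb{F}^2$, $I(P,L)=\{(x,\ell)\in P\times L: x\in\ell\}$. $\mathcal{I}(\alpha,\beta)$ denotes the claim that if $N\le|\mathbb{F}|^\beta$ then for all sets of points $P$ and lines $L$ in $\mathbb{F}^2$ with $|P|=|L|=N$ one has $|I(P,L)|\ll_{\alpha,\beta} N^\alpha$ (implied constant depending only on $\alpha,\beta$).
   Formalization: The range 2/3 < α < 4 is assumed: at α = 2/3 and α = 4 a denominator vanishes, for α < 2/3 the incidence hypothesis is vacuous (and the bound fails for α < 0, where the exponent is below 3), and for α > 4 the exponent is below 2 and the bound fails. *)

(* Defs.v *)
From mathcomp Require Import all_boot all_order all_algebra complex.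
From mathcomp Require Import all_classical all_reals all_analysis.
Set Implicit Arguments.
Unset Strict Implicit.
Unset Printing Implicit Defensive.
Import Order.TTheory GRing.Theory Num.Theory.
Local Open Scope complex_scope.
Local Open Scope ring_scope.

Section Restriction.
Variables (R : realType) (F : finFieldType).

Definition nonprincipal_additive_character (e : F -> R[i]) : Prop :=
  [/\ e 0 = 1, (forall x y : F, e (x + y) = e x * e y)
    & (exists x : F, e x != 1)].

Definition dotv n (x y : 'rV[F]_n) : F := \sum_(i < n) x 0 i * y 0 i.

(* [Normc.normc] is the real-valued modulus on [R[i]]; exponents are finite. *)
Definition norm_counting n (q : R) (f : 'rV[F]_n -> R[i]) : R :=
  (\sum_(x : 'rV[F]_n) Normc.normc (f x) `^ q) `^ q^-1.

Definition norm_surface n (S : {set 'rV[F]_n}) (p : R) (g : 'rV[F]_n -> R[i])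
    : R :=
  (#|S|%:R^-1 * \sum_(xi in S) Normc.normc (g xi) `^ p) `^ p^-1.

(* The inverse Fourier transform of the measure g dsigma; the dual of F^n is
   identified with F^n. *)
Definition extension (e : F -> R[i]) n (S : {set 'rV[F]_n})
    (g : 'rV[F]_n -> R[i]) (x : 'rV[F]_n) : R[i] :=
  #|S|%:R^-1 * \sum_(xi in S) g xi * e (dotv x xi).

(* The best constant, as an infimum in the extended reals: it is +oo when no
   finite constant is admissible. *)
Definition extension_constant (e : F -> R[i]) n (S : {set 'rV[F]_n}) (p q : R)
    : \bar R :=
  ereal_inf [set A%:E | A in
    [set A : R | 0 <= A /\
      forall g : 'rV[F]_n -> R[i], (forall xi, xi \notin S -> g xi = 0) ->
        norm_counting q (extension e S g) <= A * norm_surface S p g]]%classic.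

(* The pairs (w, w . w) for w in F^2. *)
Definition paraboloid : {set 'rV[F]_3} :=
  [set (row_mx w (\row_(_ < 1) dotv w w) : 'rV[F]_(2 + 1)) | w : 'rV[F]_2].

Definition is_line (l : {set 'rV[F]_2}) : Prop :=
  exists a d : 'rV[F]_2, d != 0 /\ l = [set a + t *: d | t : F].

Definition incidences (P : {set 'rV[F]_2}) (L : {set {set 'rV[F]_2}}) :
    {set 'rV[F]_2 * {set 'rV[F]_2}} :=
  [set z | [&& z.1 \in P, z.2 \in L & z.1 \in z.2]].

(* The incidence claim over F at exponents alpha, beta, with its implied
   constant K made explicit, so that uniformity in F can be expressed by
   quantifying K before F. *)
Definition incidence_claim (alpha beta K : R) : Prop :=
  forall N : nat, N%:R <= #|F|%:R `^ beta :> R ->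
  forall (P : {set 'rV[F]_2}) (L : {set {set 'rV[F]_2}}),
    (forall l, l \in L -> is_line l) -> #|P| = N -> #|L| = N ->
    #|incidences P L|%:R <= K * N%:R `^ alpha.

End Restriction.

Arguments paraboloid F : clear implicits.
Arguments incidence_claim {R} F alpha beta K.

(* Main.v *)
Require Import Defs.
From mathcomp Require Import all_boot all_order all_algebra complex.
From mathcomp Require Import all_classical all_reals all_analysis.
From mathcomp Require Import finfield ring lra zify.
Set Implicit Arguments.
Unset Strict Implicit.
Unset Printing Implicit Defensive.
Import Order.TTheory GRing.Theory Num.Theory.
Local Open Scope complex_scope.
Local Open Scope ring_scope.

(* Write p = |F|.  By duality it suffices to bound the energy on the paraboloid
   of the Fourier transform of a function f with |f| <= 1_G, G in F^2 x F, by
   p^2 |G|^theta with theta = (8 - alpha) / (6 - alpha): this is a weak-type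
   estimate at the exponent 2 / (2 - theta) = (12 - 2 alpha) / (4 - alpha), and
   summing over dyadic level sets costs an arbitrarily small loss in the exponent.
   - For |G| <= p^((6 - alpha) / (4 - alpha)) the Fourier decay of the paraboloid
     suffices (Stein-Tomas).
   - For larger G, cut G into horizontal slices G_z (Mockenhaupt-Tao).  The kernel
     is a Gaussian, so the convolution of a slice with it is, after a change of
     variables, again an extension operator applied to the slice; its L^4 norm
     is governed by the number of solutions of a + b = c + d,
     |a|^2 + |b|^2 = |c|^2 + |d|^2 in G_z.  These are rectangles, and as -1 is not
     a square, right angles with one point of the hypotenuse fixed are incidences
     between the points of G_z and as many distinct lines.
   - Slices with at most p^(4 (2 - alpha) / (3 alpha - 2)) points are handled by
     the incidence hypothesis, the others by the trivial N^(3/2) incidence bound,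
     which is enough because there are few of them.
   For alpha > 3/2 the trivial bound gives the result with alpha = 3/2, whose
   exponent 18/5 is smaller. *)

(** * Complex modulus and additive characters *)

Section ComplexModulus.
Variable R : realType.
Local Notation C := R[i].
Local Notation normc := (@Normc.normc R).
Implicit Types z : C.

Lemma norm_normc z : `|z| = (normc z)%:C.
Proof. by rewrite normc_def; case: z. Qed.

Lemma normc_ge0 z : 0 <= normc z.
Proof. by case: z => a b; exact: sqrtr_ge0. Qed.

Lemma sqr_normc_conj z : (normc z ^+ 2)%:C = z * conjc z.
Proof. by rewrite rmorphXn /= -norm_normc sqr_normc. Qed.

Lemma normc_conj z : normc (conjc z) = normc z.
Proof. by case: z => a b /=; rewrite sqrrN. Qed.

Lemma normc_real (a : R) : normc a%:C = `|a|.
Proof. by rewrite /= expr0n /= addr0 sqrtr_sqr. Qed.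

Lemma normcX z n : normc (z ^+ n) = normc z ^+ n.
Proof.
by elim: n => [|n IH]; rewrite ?expr0 ?Normc.normc1 // !exprS Normc.normcM IH.
Qed.

Lemma normc_sum (I : Type) (r : seq I) (P : pred I) (f : I -> C) :
  normc (\sum_(i <- r | P i) f i) <= \sum_(i <- r | P i) normc (f i).
Proof.
elim/big_ind2 : _ => [|a b c d h1 h2|i _]; rewrite ?Normc.normc0 //.
exact: le_trans (le_normcD _ _) (lerD h1 h2).
Qed.

Lemma realC_sum (I : Type) (r : seq I) (P : pred I) (f : I -> R) :
  (\sum_(i <- r | P i) f i)%:C = \sum_(i <- r | P i) (f i)%:C.
Proof. exact: rmorph_sum. Qed.

Lemma realCM (a b : R) : (a * b)%:C = a%:C * b%:C.
Proof. exact: rmorphM. Qed.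

Lemma normc_nat n : normc n%:R = n%:R.
Proof.
have -> : n%:R = (n%:R : R)%:C :> C by rewrite rmorph_nat.
by rewrite normc_real ger0_norm.
Qed.

End ComplexModulus.

Section Dot.
Variables (F : finFieldType) (n : nat).
Implicit Types u v w : 'rV[F]_n.

Lemma dotvC u v : dotv u v = dotv v u.
Proof. by apply: eq_bigr => i _; rewrite mulrC. Qed.

Lemma dotvDl u v w : dotv (u + v) w = dotv u w + dotv v w.
Proof. by rewrite -big_split; apply: eq_bigr => i _; rewrite mxE mulrDl. Qed.

Lemma dotvDr u v w : dotv w (u + v) = dotv w u + dotv w v.
Proof. by rewrite dotvC dotvDl !(dotvC w). Qed.

Lemma dotvZl c u v : dotv (c *: u) v = c * dotv u v.
Proof. by rewrite mulr_sumr; apply: eq_bigr => i _; rewrite mxE mulrA. Qed.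

Lemma dotvZr c u v : dotv u (c *: v) = c * dotv u v.
Proof. by rewrite dotvC dotvZl dotvC. Qed.

Lemma dotvNl u v : dotv (- u) v = - dotv u v.
Proof. by rewrite -scaleN1r dotvZl mulN1r. Qed.

Lemma dotvNr u v : dotv u (- v) = - dotv u v.
Proof. by rewrite dotvC dotvNl dotvC. Qed.

Lemma dotv0l v : dotv 0 v = 0.
Proof. by rewrite -(scale0r v) dotvZl mul0r. Qed.

End Dot.

Definition dotvE := (dotvDl, dotvDr, dotvNl, dotvNr, dotvZl, dotvZr).

Section Characters.
Variables (R : realType) (F : finFieldType) (e : F -> R[i]).
Hypothesis he : nonprincipal_additive_character e.
Local Notation normc := (@Normc.normc R).

Lemma char0 : e 0 = 1. Proof. by case: he. Qed.

Lemma charD x y : e (x + y) = e x * e y. Proof. by case: he. Qed.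

(** Every value of [e] is a root of unity: [e x ^+ p = e (x *+ p) = 1], with [p] the characteristic
    of [F]. *)
Lemma normc_char x : normc (e x) = 1.
Proof.
have [p pp pF] := finPcharP F.
have e_mulrn n : e (x *+ n) = e x ^+ n.
  by elim: n => [|n IH]; rewrite ?char0 // mulrS charD IH exprS.
have := congr1 normc (e_mulrn p).
rewrite (mulrn_pchar pF) char0 Normc.normc1 normcX => /esym/eqP.
by rewrite pexpr_eq1 ?normc_ge0 ?prime_gt0 // => /eqP.
Qed.

Lemma conj_char x : conjc (e x) = e (- x).
Proof.
have nz : e x != 0.
  by apply/eqP => e0; have := normc_char x; rewrite e0 Normc.normc0 => /eqP; rewrite eq_sym oner_eq0.
apply: (mulfI nz); rewrite -sqr_normc_conj normc_char expr1n.
by rewrite -charD subrr char0.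
Qed.

(** Translating the summation variable by [a] multiplies the sum by [chi a], which is not 1. *)
Lemma sum_mult_eq0 (A : finZmodType) (chi : A -> R[i]) (a : A) :
  (forall x y, chi (x + y) = chi x * chi y) -> chi a != 1 ->
  \sum_x chi x = 0.
Proof.
move=> chiD ha; have : chi a * \sum_x chi x = \sum_x chi x.
  rewrite mulr_sumr [RHS](reindex_inj (addrI a)) /=.
  by apply: eq_bigr => x _; rewrite chiD.
by move/eqP; rewrite -subr_eq0 -{2}[\sum_x _]mul1r -mulrBl mulf_eq0 subr_eq0 (negPf ha) => /eqP.
Qed.

Lemma sum_char (a : F) : \sum_x e (a * x) = if a == 0 then #|F|%:R else 0.
Proof.
have [->|a0] := eqVneq a 0.
  by under eq_bigr do rewrite mul0r char0; rewrite sumr_const.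
have [_ _ [x hx]] := he.
apply: (@sum_mult_eq0 _ _ (a^-1 * x)) => [y z|]; first by rewrite mulrDr charD.
by rewrite mulVKf.
Qed.

Lemma sum_char_dotv n (u : 'rV[F]_n) :
  \sum_v e (dotv u v) = if u == 0 then (#|F| ^ n)%:R else 0.
Proof.
have [->|u0] := eqVneq u 0.
  under eq_bigr do rewrite dotv0l char0.
  by rewrite sumr_const card_mx mul1n.
have [_ _ [x hx]] := he.
have [i ui] : exists i, u 0 i != 0.
  apply/existsP; apply: contraNT u0 => /existsPn u0; apply/eqP/rowP => i.
  by rewrite mxE; have := u0 i; rewrite negbK => /eqP.
apply: (@sum_mult_eq0 _ _ (((u 0 i)^-1 * x) *: delta_mx 0 i)) => [y z|].
  by rewrite dotvDr charD.
rewrite dotvZr /dotv (bigD1 i) //= big1 ?addr0 => [|j ji].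
  by rewrite mxE !eqxx mulr1 mulrAC mulVf ?mul1r.
by rewrite mxE eqxx (negPf ji) mulr0.
Qed.

Lemma sum_char_prod n (u : 'rV[F]_n) (s : F) :
  \sum_(x : 'rV[F]_n * F) e (dotv u x.1 + s * x.2) =
  if (u, s) == 0 then (#|F| ^ n.+1)%:R else 0.
Proof.
transitivity ((\sum_v e (dotv u v)) * \sum_t e (s * t)).
  rewrite big_distrlr /= pair_bigA; apply: eq_bigr => -[v t] _ /=.
  exact: charD.
rewrite sum_char_dotv sum_char xpair_eqE; case: (u == 0) => /=; rewrite ?mul0r //.
by case: (s == 0); rewrite ?mulr0 // -natrM -expnSr.
Qed.

End Characters.

(** * Rectangles and incidences in the plane *)

Lemma sum_cauchy_schwarz (R : realDomainType) (I : finType) (P : pred I)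
    (a b : I -> R) :
  (\sum_(i | P i) a i * b i) ^+ 2 <=
  (\sum_(i | P i) a i ^+ 2) * (\sum_(i | P i) b i ^+ 2).
Proof.
(* Lagrange's identity: this sum of squares is twice the difference of the two sides. *)
set X := \sum_(i | P i) \sum_(j | P j) (a i * b j - a j * b i) ^+ 2.
have X0 : 0 <= X by apply: sumr_ge0 => i _; apply: sumr_ge0 => j _; exact: sqr_ge0.
suff XE : X = 2 * ((\sum_(i | P i) a i ^+ 2) * (\sum_(i | P i) b i ^+ 2)
                   - (\sum_(i | P i) a i * b i) ^+ 2).
  by move: X0; rewrite XE pmulr_rge0 ?subr_ge0.
transitivity (\sum_(i | P i) \sum_(j | P j)
  (a i ^+ 2 * b j ^+ 2 + b i ^+ 2 * a j ^+ 2 - 2 * ((a i * b i) * (a j * b j)))).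
  by apply: eq_bigr => i _; apply: eq_bigr => j _; ring.
under eq_bigr do rewrite sumrB big_split /= -!mulr_sumr.
rewrite sumrB big_split /= -mulr_sumr -!mulr_suml expr2.
ring.
Qed.

Section PlaneGeometry.
Variable F : finFieldType.
Hypothesis F_aniso : forall x : F, x ^+ 2 != -1.
Local Notation V := 'rV[F]_2.
Implicit Types (a b c u v w : V) (P E : {set V}) (L : {set {set V}}).

Lemma two_neq0 : 2 != 0 :> F.
Proof.
apply/eqP => two0; have /eqP[] := F_aniso 1.
by rewrite expr1n; apply/eqP; rewrite -subr_eq0 opprK; apply/eqP.
Qed.

Lemma dotv2E u v : dotv u v = u 0 0 * v 0 0 + u 0 1 * v 0 1.
Proof.
rewrite /dotv !big_ord_recl big_ord0 addr0.
by have -> : lift ord0 ord0 = 1 :> 'I_2 by exact: val_inj.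
Qed.

Lemma row2P u v : u 0 0 = v 0 0 -> u 0 1 = v 0 1 -> u = v.
Proof.
move=> h0 h1; apply/rowP => -[[|[|//]] hi].
  by rewrite (_ : Ordinal hi = 0) //; exact: val_inj.
by rewrite (_ : Ordinal hi = 1) //; exact: val_inj.
Qed.

(** If the second coordinate of an isotropic [u] were nonzero, the quotient of its coordinates would
    be a square root of -1. *)
Lemma dotv_eq0 u : dotv u u = 0 -> u = 0.
Proof.
rewrite dotv2E => uu.
have u1 : u 0 1 = 0.
  apply/eqP/negPn/negP => u1; have /eqP[] := F_aniso (u 0 0 / u 0 1).
  have -> : (u 0 0 / u 0 1) ^+ 2 = (u 0 0 * u 0 0 + u 0 1 * u 0 1) / u 0 1 ^+ 2 - 1 by field.
  by rewrite uu mul0r sub0r.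
move: uu; rewrite u1 mulr0 addr0 => /eqP; rewrite mulf_eq0 orbb => /eqP u0.
by apply: row2P; rewrite ?u0 ?u1 mxE.
Qed.

Definition rot u : V := \row_i (if i == 0 then - u 0 1 else u 0 0).

Lemma rot_eq0 u : (rot u == 0) = (u == 0).
Proof.
apply/eqP/eqP => [ru|->]; last by apply: row2P; rewrite !mxE ?oppr0.
have := congr1 (fun w : V => w 0 0) ru; have := congr1 (fun w : V => w 0 1) ru.
rewrite !mxE /= => u0 /eqP; rewrite oppr_eq0 => /eqP u1.
by apply: row2P; rewrite mxE.
Qed.

Lemma dotv_rot u t : dotv u (t *: rot u) = 0.
Proof. by rewrite dotv2E !mxE /=; ring. Qed.

Lemma dotv_eq0_rot u w : u != 0 -> dotv u w = 0 -> exists t, w = t *: rot u.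
Proof.
rewrite dotv2E => u0 uw.
have [u00|u00] := eqVneq (u 0 0) 0.
  have u01 : u 0 1 != 0.
    by apply: contraNneq u0 => u01; apply/eqP/row2P; rewrite ?u00 ?u01 mxE.
  exists (- (w 0 0 / u 0 1)); apply: row2P; rewrite !mxE /=; first by field.
  move: uw; rewrite u00 mul0r add0r mulr0 => /eqP.
  by rewrite mulf_eq0 (negPf u01) => /eqP.
exists (w 0 1 / u 0 0); apply: row2P; rewrite !mxE /=; last by field.
apply: (mulfI u00); move/eqP: uw; rewrite addr_eq0 => /eqP ->; field.
by [].
Qed.

Lemma line_through2 (l : {set V}) (x y : V) : is_line l -> x \in l -> y \in l ->
  x != y -> l = [set x + t *: (y - x) | t : F].
Proof.
move=> [a [d [d0 ->]]] /imsetP[s _ ->] /imsetP[t _ ->] xy.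
have ts : t - s != 0.
  by apply: contraNneq xy => /eqP; rewrite subr_eq0 => /eqP ->.
have E r : a + s *: d + r *: (a + t *: d - (a + s *: d)) = a + (s + r * (t - s)) *: d.
  by rewrite opprD addrACA subrr add0r -scalerBl scalerA -addrA -scalerDl.
apply/setP => z; apply/imsetP/imsetP => -[r _ ->].
  by exists ((r - s) / (t - s)) => //; rewrite E divfK // subrKC.
by exists (s + r * (t - s)).
Qed.

Lemma card_incidences P L :
  #|incidences P L| = (\sum_(l in L) \sum_(x in P) (x \in l))%N.
Proof.
rewrite exchange_big pair_big -sum1dep_card big_mkcond [RHS]big_mkcond /=.
by apply: eq_bigr => -[x l] _ /=; case: (x \in P); case: (l \in L); case: (x \in l).
Qed.

(** Cauchy-Schwarz over the lines leads to counting pairs of points on a common line: equal points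
    share at most [N] lines, distinct points at most one. *)
Lemma card_incidences_sqr_le P L N : (forall l, l \in L -> is_line l) ->
  #|P| = N -> #|L| = N -> (#|incidences P L| ^ 2 <= 2 * N ^ 3)%N.
Proof.
move=> Ll PN LN.
pose k (l : {set V}) := (\sum_(x in P) (x \in l))%N.
have CS : (#|incidences P L| ^ 2 <= N * \sum_(l in L) k l ^ 2)%N.
  have := @sum_cauchy_schwarz int _ (mem L) (fun=> 1) (fun l => (k l)%:R).
  rewrite /=.
  under eq_bigr do rewrite mul1r.
  under [X in _ <= X * _]eq_bigr do rewrite expr1n.
  under [X in _ <= _ * X]eq_bigr do rewrite -natrX.
  rewrite sumr_const -!natr_sum LN -natrX -natrM ler_nat.
  by rewrite card_incidences.
apply: (leq_trans CS).
suff : (\sum_(l in L) k l ^ 2 <= 2 * N ^ 2)%N.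
  by move=> h; rewrite (leq_trans (leq_mul (leqnn N) h)) //; nia.
have -> : (\sum_(l in L) k l ^ 2 =
    \sum_(x in P) \sum_(y in P) \sum_(l in L) ((x \in l) && (y \in l)))%N.
  under [RHS]eq_bigr do rewrite exchange_big.
  rewrite [RHS]exchange_big; apply: eq_bigr => l _.
  rewrite -mulnn /k big_distrl; apply: eq_bigr => x _ /=.
  by rewrite big_distrr; apply: eq_bigr => y _ /=; rewrite mulnb.
apply: (@leq_trans (\sum_(x in P) (N + N))%N); last by rewrite sum_nat_const PN; nia.
apply: leq_sum => x xP; rewrite (bigD1 x) //= leq_add //.
  by rewrite -[leqRHS]LN -sum1_card leq_sum // => l _; case: (_ && _).
rewrite -[leqRHS]PN -[leqRHS]sum1_card [leqRHS](bigD1 x) //= -[leqLHS]add0n leq_add //.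
apply: leq_sum => y /andP[yP yx].
have [/existsP[l /and3P[lL xl yl]]|/existsPn nol] :=
    boolP [exists l, [&& l \in L, x \in l & y \in l]]; last first.
  by rewrite big1 // => l lL; have := nol l; rewrite lL /= => /negPf ->.
rewrite (bigD1 l) //= xl yl big1 // => l' /andP[l'L l'l].
apply/eqP; rewrite eqb0; apply: contra l'l => /andP[xl' yl'].
have xy : x != y by rewrite eq_sym.
by rewrite (line_through2 (Ll _ lL) xl yl xy) (line_through2 (Ll _ l'L) xl' yl' xy).
Qed.

(** A pair [(b, c)] stands for a right angle at [c] whose hypotenuse joins [a] and [b]; degenerate
    angles are allowed. *)
Definition right_angles E a : {set V * V} :=
  [set z | [&& z.1 \in E, z.2 \in E & dotv (a - z.2) (z.1 - z.2) == 0]].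

(* The line through c perpendicular to a - c, with an arbitrary direction when c = a. *)
Definition perp_line a c : {set V} :=
  [set c + t *: rot (if c == a then const_mx 1 else a - c) | t : F].

Lemma perp_line_is_line a c : is_line (perp_line a c).
Proof.
exists c, (rot (if c == a then const_mx 1 else a - c)); split=> //.
rewrite rot_eq0; case: (eqVneq c a) => [_|ca]; last by rewrite subr_eq0 eq_sym.
by apply/eqP => /rowP/(_ 0); rewrite !mxE => /eqP; rewrite oner_eq0.
Qed.

Lemma mem_perp_line a b c : c != a ->
  (b \in perp_line a c) = (dotv (a - c) (b - c) == 0).
Proof.
move=> ca; have ac : a - c != 0 by rewrite subr_eq0 eq_sym.
apply/imsetP/eqP => [[t _ ->]|/(dotv_eq0_rot ac)[t bc]].
  by rewrite (negPf ca) addrAC subrr add0r dotv_rot.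
by exists t => //; rewrite (negPf ca) -bc subrKC.
Qed.

Lemma perp_line_self a c : c \in perp_line a c.
Proof. by apply/imsetP; exists 0 => //; rewrite scale0r addr0. Qed.

(** For [c != a] the line misses [a] and [c] is the foot of the perpendicular from [a]. The foot is
    unique: the difference of two feet would be isotropic. *)
Lemma perp_line_inj a : injective (perp_line a).
Proof.
have base c : c != a -> a \notin perp_line a c.
  move=> ca; rewrite mem_perp_line //; apply: contra ca => /eqP/dotv_eq0/eqP.
  by rewrite subr_eq0 eq_sym.
move=> c c' cc'; have [ca|ca] := eqVneq c a.
  apply/esym; have [c'a|/base] := eqVneq c' a; first by rewrite c'a.
  by rewrite -cc' ca perp_line_self.
have [c'a|c'a] := eqVneq c' a; first by move: (base _ ca); rewrite cc' c'a perp_line_self.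
have /eqP h1 : dotv (a - c) (c' - c) == 0 by rewrite -mem_perp_line // cc' perp_line_self.
have /eqP h2 : dotv (a - c') (c - c') == 0 by rewrite -mem_perp_line // -cc' perp_line_self.
apply/eqP; rewrite eq_sym -subr_eq0; apply/eqP/dotv_eq0.
have -> : dotv (c' - c) (c' - c) = dotv (a - c) (c' - c) + dotv (a - c') (c - c').
  by rewrite !dotvE; ring.
by rewrite h1 h2 addr0.
Qed.

(** For [c != a], the pair [(b, c)] becomes the incidence of [b] with [perp_line a c]. There are at
    most [#|E|] pairs with [c = a], and at least as many incidences, since each [c] lies on its own
    line; hence the factor 2. *)
Lemma card_right_angles_le E a :
  exists L, [/\ forall l, l \in L -> is_line l, #|L| = #|E|
    & (#|right_angles E a| <= 2 * #|incidences E L|)%N].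
Proof.
exists [set perp_line a c | c in E]; set L := [set _ | _ in E]; split.
- by move=> l /imsetP[c _ ->]; exact: perp_line_is_line.
- by rewrite card_imset //; exact: perp_line_inj.
have EL : (#|E| <= #|incidences E L|)%N.
  have inj : injective (fun c => (c, perp_line a c)) by move=> c c' [].
  rewrite -(card_imset E inj) subset_leq_card //.
  by apply/fintype.subsetP => _ /imsetP[c cE ->]; rewrite !inE /= cE perp_line_self imset_f.
apply: (@leq_trans (#|finset.setX E [set a]| + #|incidences E L|)%N); last first.
  by rewrite cardsX cards1 muln1 mul2n -addnn leq_add2r.
have inj : injective (fun z : V * V => (z.1, perp_line a z.2)).
  by move=> [x c] [x' c'] [-> /perp_line_inj ->].
rewrite -(cardsID (finset.setX E [set a]) (right_angles E a)).
apply: leq_add; first by rewrite subset_leq_card // finset.subsetIr.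
rewrite -(card_imset _ inj) subset_leq_card //.
apply/fintype.subsetP => _ /imsetP[[b c] + ->]; rewrite !inE /= => /andP[+ /and3P[bE cE abc]].
by rewrite bE /= => ca; rewrite imset_f // mem_perp_line.
Qed.

Definition energy E : nat :=
  #|[set q : (V * V) * (V * V) |
      [&& q.1.1 \in E, q.1.2 \in E, q.2.1 \in E, q.2.2 \in E,
          q.1.1 + q.1.2 == q.2.1 + q.2.2 &
          dotv q.1.1 q.1.1 + dotv q.1.2 q.1.2 ==
          dotv q.2.1 q.2.1 + dotv q.2.2 q.2.2]]|.

(* If a + b = c + d and |a|^2 + |b|^2 = |c|^2 + |d|^2 then 2 (a - c).(b - c) = 0:
   such quadruples are rectangles. *)
Lemma energy_le E : (energy E <= \sum_(a in E) #|right_angles E a|)%N.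
Proof.
rewrite /energy; set Q := [set _ | _].
(* The first three points of a quadruple determine the fourth. *)
pose f (q : (V * V) * (V * V)) := (q.1.1, (q.1.2, q.2.1)).
have inj : {in Q &, injective f}.
  move=> [[a b] [c d]] [[a' b'] [c' d']]; rewrite !inE /=.
  move=> /and5P[_ _ _ _ /andP[/eqP h _]] /and5P[_ _ _ _ /andP[/eqP h' _]].
  case=> aa bb cc; rewrite -aa -bb -cc in h' *.
  by congr (_, (_, _)); apply: (addrI c); rewrite -h -h'.
rewrite -(card_in_imset inj).
under eq_bigr do rewrite -sum1_card.
rewrite pair_big_dep /= sum1_card subset_leq_card //.
apply/fintype.subsetP => _ /imsetP[[[a b] [c d]] + ->]; rewrite !inE /=.
move=> /and5P[aE bE cE dE /andP[/eqP h /eqP h2]].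
rewrite unfold_in /= !inE /= aE bE cE; apply/eqP.
have dE' : d = a + b - c by rewrite h addrC addKr.
apply: (mulfI two_neq0); rewrite mulr0.
apply: (etrans (y := dotv c c + dotv d d - (dotv a a + dotv b b))).
  by rewrite dE' !dotvE (dotvC b a) (dotvC c a) (dotvC c b); ring.
by rewrite h2 subrr.
Qed.

End PlaneGeometry.

(** * Fourier analysis on the paraboloid *)

(** Cauchy-Schwarz against the constant 1, applied twice. *)
Lemma sum_expr4_le (R : realDomainType) (I : finType) (P : pred I) (a : I -> R) :
  (\sum_(i | P i) a i) ^+ 4 <= #|P|%:R ^+ 3 * \sum_(i | P i) a i ^+ 4.
Proof.
have CS (b : I -> R) : (\sum_(i | P i) b i) ^+ 2 <= #|P|%:R * \sum_(i | P i) b i ^+ 2.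
  have := sum_cauchy_schwarz P (fun=> 1) b; rewrite /=.
  under eq_bigr do rewrite mul1r.
  by under [X in _ <= X * _]eq_bigr do rewrite expr1n; rewrite sumr_const.
have s0 : 0 <= \sum_(i | P i) a i ^+ 2 by apply: sumr_ge0 => i _; exact: sqr_ge0.
rewrite -[4%N]/(2 * 2)%N exprM.
apply: (@le_trans _ _ ((#|P|%:R * \sum_(i | P i) a i ^+ 2) ^+ 2)).
  by rewrite lerXn2r ?nnegrE ?sqr_ge0 ?mulr_ge0.
rewrite exprMn [_ ^+ 3]exprSr -mulrA ler_wpM2l ?sqr_ge0 //.
by under [X in _ <= _ * X]eq_bigr do rewrite exprM; exact: CS.
Qed.

Section FourierParaboloid.
Variables (R : realType) (F : finFieldType) (e : F -> R[i]).
Hypothesis he : nonprincipal_additive_character e.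
Hypothesis F_aniso : forall x : F, x ^+ 2 != -1.
Local Notation normc := (@Normc.normc R).
Local Notation V := 'rV[F]_2.
Local Notation p := (#|F|%:R : R).

Let four_neq0 : 4 != 0 :> F.
Proof. by rewrite -[4%N]/(2 * 2)%N natrM mulf_neq0 ?two_neq0. Qed.

(** Up to the factor [#|F| ^ 2], this is the inverse Fourier transform of the surface measure at
    [(u, s)]. *)
Definition paraboloid_kernel (u : V) (s : F) : R[i] :=
  \sum_w e (dotv w u + dotv w w * s).

Lemma paraboloid_kernel0 u :
  paraboloid_kernel u 0 = if u == 0 then (#|F| ^ 2)%:R else 0.
Proof.
rewrite -(sum_char_dotv he); apply: eq_bigr => w _.
by rewrite mulr0 addr0 dotvC.
Qed.

(** Completing the square: shifting [w] by [- u / (2 s)] removes the linear term. *)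
Lemma paraboloid_kernel_square u s : s != 0 ->
  paraboloid_kernel u s = e (- (dotv u u / (4 * s))) * paraboloid_kernel 0 s.
Proof.
move=> s0; rewrite /paraboloid_kernel mulr_sumr.
rewrite (reindex_inj (addIr (- ((2 * s)^-1 *: u)))) /=.
apply: eq_bigr => w _; rewrite -charD //; congr e.
rewrite !dotvE (dotvC u w) [dotv w 0]dotvC dotv0l; field.
by rewrite s0 four_neq0 two_neq0.
Qed.

(** In the squared modulus, taking the difference of the two variables as a new variable [u] makes
    the phase linear in [w]; orthogonality leaves only [u = 0], which contributes [p ^+ 2]. *)
Lemma normc_gauss_sum s : s != 0 -> normc (paraboloid_kernel 0 s) = p.
Proof.
move=> s0; apply: (@pexpIrn R 2 isT); rewrite ?nnegrE ?normc_ge0 ?ler0n //.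
apply: complexI; rewrite sqr_normc_conj rmorphXn rmorph_nat /=.
rewrite /paraboloid_kernel raddf_sum mulrC big_distrlr /=.
transitivity (\sum_(w : V) \sum_(u : V) e (dotv u u * s) * e (dotv ((2 * s) *: u) w)).
  apply: eq_bigr => w _; rewrite (reindex_inj (addrI w)) /=.
  apply: eq_bigr => u _; rewrite conj_char // -!charD //; congr e.
  by rewrite !dotvE (dotvC u w) !(dotvC _ 0) !dotv0l; ring.
rewrite exchange_big; under eq_bigr do rewrite -mulr_sumr (sum_char_dotv he).
rewrite (bigD1 0) //= big1 => [|u u0]; last first.
  by rewrite scaler_eq0 mulf_eq0 (negPf (two_neq0 F_aniso)) (negPf s0) (negPf u0) mulr0.
by rewrite scaler0 eqxx dotv0l mul0r char0 // mul1r addr0 natrX.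
Qed.

Lemma normc_paraboloid_kernel_le u s : (u, s) != 0 -> normc (paraboloid_kernel u s) <= p.
Proof.
have [->|s0 _] := eqVneq s 0; last first.
  by rewrite paraboloid_kernel_square // Normc.normcM normc_char // mul1r normc_gauss_sum.
by rewrite xpair_eqE eqxx andbT paraboloid_kernel0 => /negPf ->; rewrite Normc.normc0.
Qed.

(** Plancherel: orthogonality of characters keeps only the pairs with equal frequencies. *)
Lemma sum_sqr_normc_char_le (I : finType) (c : I -> R[i]) (k : I -> V * F) :
  \sum_(x : V * F) normc (\sum_i c i * e (dotv (k i).1 x.1 + (k i).2 * x.2)) ^+ 2 <=
  p ^+ 3 * \sum_i \sum_(j | k i == k j) normc (c i) * normc (c j).
Proof.
set S := (X in X <= _).
have SE : S%:C = (#|F| ^ 3)%:R * \sum_i \sum_(j | k i == k j) c i * conjc (c j).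
  rewrite /S realC_sum.
  under eq_bigr => x _.
    rewrite sqr_normc_conj raddf_sum big_distrlr /=.
    over.
  rewrite exchange_big mulr_sumr; apply: eq_bigr => i _.
  rewrite exchange_big mulr_sumr [RHS]big_mkcond; apply: eq_bigr => j _.
  transitivity (c i * conjc (c j) * \sum_(x : V * F)
      e (dotv ((k i).1 - (k j).1) x.1 + ((k i).2 - (k j).2) * x.2)).
    rewrite mulr_sumr; apply: eq_bigr => x _; rewrite rmorphM /= conj_char //.
    rewrite mulrACA -charD //; congr (_ * e _).
    by rewrite !dotvE; ring.
  rewrite sum_char_prod // -[(_, _)]/(k i - k j) subr_eq0.
  by case: (k i == k j); rewrite ?mulr0 // mulrC.
have S0 : 0 <= S by apply: sumr_ge0 => x _; exact: sqr_ge0.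
rewrite -[S]ger0_norm // -normc_real SE Normc.normcM normc_nat natrX ler_wpM2l ?exprn_ge0 //.
apply: (le_trans (normc_sum _ _ _)); apply: ler_sum => i _.
apply: (le_trans (normc_sum _ _ _)); apply: ler_sum => j _.
by rewrite Normc.normcM normc_conj.
Qed.

Definition slice (G : {set V * F}) z : {set V} := [set y | (y, z) \in G].

Section Restriction.
Variables (G : {set V * F}) (f : V * F -> R[i]).
Hypothesis hf : forall x, normc (f x) <= (x \in G)%:R.
Local Notation m := (#|G|%:R : R).

(** The transpose of the extension operator, up to normalisation; see [pairing_extension]. *)
Definition paraboloid_transform (w : V) : R[i] :=
  \sum_(x : V * F) f x * e (dotv w x.1 + dotv w w * x.2).

Lemma sum_sqr_transform :
  (\sum_w normc (paraboloid_transform w) ^+ 2)%:C =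
  \sum_(x : V * F) conjc (f x) * \sum_(y : V * F)
    f y * paraboloid_kernel (y.1 - x.1) (y.2 - x.2).
Proof.
rewrite realC_sum.
under eq_bigr => w _.
  rewrite sqr_normc_conj raddf_sum mulrC big_distrlr /=.
  over.
rewrite exchange_big; apply: eq_bigr => x _.
rewrite exchange_big mulr_sumr; apply: eq_bigr => y _.
rewrite !mulr_sumr; apply: eq_bigr => w _.
rewrite rmorphM /= conj_char // mulrACA -charD // -mulrA; congr (_ * (_ * e _)).
by rewrite !dotvE; ring.
Qed.

Lemma sum_sqr_transform_le (M : V * F -> R) :
  (forall x, x \in G ->
    normc (\sum_(y : V * F) f y * paraboloid_kernel (y.1 - x.1) (y.2 - x.2)) <= M x) ->
  \sum_w normc (paraboloid_transform w) ^+ 2 <= \sum_(x in G) M x.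
Proof.
move=> hM; set S := \sum_w _.
have S0 : 0 <= S by apply: sumr_ge0 => x _; exact: sqr_ge0.
rewrite -[S]ger0_norm // -normc_real sum_sqr_transform.
apply: (le_trans (normc_sum _ _ _)); rewrite [leRHS]big_mkcond.
apply: ler_sum => x _; rewrite Normc.normcM normc_conj.
have := hf x; case: ifPn => xG fx; last first.
  by rewrite (_ : normc (f x) = 0) ?mul0r //; apply/eqP; rewrite eq_le fx normc_ge0.
by rewrite (le_trans _ (hM x xG)) // ler_piMl // normc_ge0.
Qed.

(** The diagonal contributes the kernel at the origin, [p ^+ 2]; every other point of [G]
    contributes at most [p] by Fourier decay. *)
Lemma stein_tomas :
  \sum_w normc (paraboloid_transform w) ^+ 2 <= p ^+ 2 * m + p * m ^+ 2.
Proof.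
apply: (le_trans (sum_sqr_transform_le (M := fun=> p ^+ 2 + p * m) _)); last first.
  by rewrite sumr_const -[_ *+ _]mulr_natr; lra.
move=> x xG; apply: (le_trans (normc_sum _ _ _)).
apply: (@le_trans _ _ (\sum_(y in G) normc (paraboloid_kernel (y.1 - x.1) (y.2 - x.2)))).
  rewrite [leRHS]big_mkcond; apply: ler_sum => y _; rewrite Normc.normcM.
  have := hf y; case: ifPn => yG fy; first by rewrite ler_piMl ?normc_ge0.
  by rewrite (_ : normc (f y) = 0) ?mul0r //; apply/eqP; rewrite eq_le fy normc_ge0.
rewrite (bigD1 x) //= !subrr paraboloid_kernel0 eqxx normc_nat natrX lerD2l.
apply: (@le_trans _ _ (\sum_(y in G | y != x) p)).
  apply: ler_sum => y /andP[_ yx]; apply: normc_paraboloid_kernel_le.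
  by rewrite -[(_, _)]/(y - x) subr_eq0.
have -> : p * m = \sum_(y in G) p by rewrite sumr_const mulr_natr.
by rewrite [leRHS](bigD1 x) //= lerDr.
Qed.

(** The slice at height [z], lifted to the paraboloid and extended from there without
    normalisation. *)
Definition slice_transform z (x : V * F) : R[i] :=
  \sum_y f (y, z) * e (dotv y x.1 + dotv y y * x.2).

(** The square of the transform is an exponential sum over pairs of points; two pairs have the same
    frequency exactly when they form a quadruple counted by [energy]. *)
Lemma slice_transform_L4 z :
  \sum_(x : V * F) normc (slice_transform z x) ^+ 4 <= p ^+ 3 * (energy (slice G z))%:R.
Proof.
pose c (i : V * V) := f (i.1, z) * f (i.2, z).
pose k (i : V * V) := (i.1 + i.2, dotv i.1 i.1 + dotv i.2 i.2).
have -> : \sum_(x : V * F) normc (slice_transform z x) ^+ 4 =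
   \sum_(x : V * F) normc (\sum_i c i * e (dotv (k i).1 x.1 + (k i).2 * x.2)) ^+ 2.
  apply: eq_bigr => x _; rewrite -[4%N]/(2 * 2)%N exprM; congr (_ ^+ 2).
  rewrite -normcX expr2 /slice_transform big_distrlr pair_bigA /=; congr normc.
  apply: eq_bigr => -[a b] _ /=; rewrite mulrACA -charD //; congr (_ * e _).
  by rewrite !dotvE; ring.
apply: (le_trans (sum_sqr_normc_char_le _ _)); rewrite ler_wpM2l ?exprn_ge0 //.
rewrite pair_big_dep /= /energy -sum1_card natr_sum [leRHS]big_mkcond [leLHS]big_mkcond /=.
apply: ler_sum => -[[a b] [a' b']] _; rewrite !inE xpair_eqE /c /=.
have h (x y : V) : normc (f (x, z) * f (y, z)) <= (((x, z) \in G) && ((y, z) \in G))%:R.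
  by rewrite Normc.normcM -mulnb natrM ler_pM ?normc_ge0.
have := ler_pM (normc_ge0 _) (normc_ge0 _) (h a b) (h a' b').
rewrite -natrM mulnb.
case: ((a, z) \in G); case: ((b, z) \in G); case: ((a', z) \in G);
  by case: ((b', z) \in G); case: ifP.
Qed.

(** Once [|y - x|^2] is expanded, the term in [x] alone is a phase that the modulus ignores, the
    other terms form the phase of [slice_transform] at a new point, and the Gauss sum contributes
    [p]. *)
Lemma normc_slice_kernel z (x : V * F) : x.2 != z ->
  normc (\sum_y f (y, z) * paraboloid_kernel (y - x.1) (z - x.2)) =
  p * normc (slice_transform z ((2 * (z - x.2))^-1 *: x.1, - (4 * (z - x.2))^-1)).
Proof.
case: x => x t /= zt; set s := z - t.
have s0 : s != 0 by rewrite subr_eq0 eq_sym.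
rewrite -(normc_gauss_sum s0) -[in RHS](mul1r (normc (slice_transform _ _))).
rewrite -(normc_char he (- (dotv x x / (4 * s)))) -!Normc.normcM; congr normc.
rewrite /slice_transform !mulr_sumr; apply: eq_bigr => y _ /=.
rewrite paraboloid_kernel_square //.
have -> : - (dotv (y - x) (y - x) / (4 * s)) = - (dotv x x / (4 * s)) +
    (dotv y ((2 * s)^-1 *: x) + dotv y y * - (4 * s)^-1).
  rewrite !dotvE (dotvC x y); field.
  by rewrite s0 four_neq0 two_neq0.
by rewrite (charD he (- (dotv x x / (4 * s)))) [RHS]mulrC -!mulrA mulrCA.
Qed.

(** Hölder with exponents 4/3 and 4. The change of variables [k] is injective off the slice, so the
    fourth powers sampled along it are bounded by the full L^4 norm. *)
Lemma sum_slice_kernel_le z :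
  exists S : R, [/\ 0 <= S, S ^+ 4 <= m ^+ 3 * (p ^+ 3 * (energy (slice G z))%:R) &
    \sum_(x in G | x.2 != z) normc (\sum_y f (y, z) * paraboloid_kernel (y - x.1) (z - x.2))
    <= p * S].
Proof.
pose k (x : V * F) := ((2 * (z - x.2))^-1 *: x.1, - (4 * (z - x.2))^-1).
have k_inj : {in [pred x : V * F | x.2 != z] &, injective k}.
  move=> [x t] [x' t']; rewrite !inE /= => tz tz' [].
  move=> + /eqP; rewrite eqr_opp => + /eqP/invr_inj/(mulfI four_neq0)/addrI/oppr_inj tt.
  rewrite tt => /scalerI -> //.
  by rewrite invr_neq0 // mulf_neq0 ?two_neq0 // subr_eq0 eq_sym.
exists (\sum_(x in G | x.2 != z) normc (slice_transform z (k x))); split.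
- by apply: sumr_ge0 => x _; exact: normc_ge0.
- apply: (le_trans (sum_expr4_le _ _)); apply: ler_pM.
  + exact: exprn_ge0.
  + by apply: sumr_ge0 => x _; rewrite exprn_ge0 ?normc_ge0.
  + rewrite lerXn2r ?nnegrE // ler_nat subset_leq_card //.
    by apply/fintype.subsetP => x /andP[].
  + apply: le_trans (slice_transform_L4 z).
    pose A : {set V * F} := [set x in G | x.2 != z].
    have kA : {in A &, injective k}.
      by move=> x y; rewrite !inE => /andP[_ xz] /andP[_ yz]; exact: k_inj.
    have -> : \sum_(x in G | x.2 != z) normc (slice_transform z (k x)) ^+ 4 =
        \sum_(x in [set k x | x in A]) normc (slice_transform z x) ^+ 4.
      by rewrite big_imset //=; apply: eq_bigl => x; rewrite inE.
    rewrite [leRHS](bigID (mem [set k x | x in A])) /= lerDl.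
    by apply: sumr_ge0 => x _; rewrite exprn_ge0 ?normc_ge0.
- rewrite mulr_sumr; apply: ler_sum => x /andP[_ xz].
  by rewrite normc_slice_kernel.
Qed.

(** Seen from [x], the slice at the height of [x] meets the kernel only at [x] itself and costs
    [p ^+ 2]; each other slice, summed over [x] in [G], costs [p * S z]. *)
Lemma mockenhaupt_tao : exists S : F -> R,
  (forall z, 0 <= S z /\ S z ^+ 4 <= m ^+ 3 * (p ^+ 3 * (energy (slice G z))%:R)) /\
  \sum_w normc (paraboloid_transform w) ^+ 2 <= p ^+ 2 * m + p * \sum_z S z.
Proof.
have [S hS] := choice sum_slice_kernel_le.
exists S; split=> [z|]; first by have [] := hS z.
apply: (le_trans (sum_sqr_transform_le (M := fun x : V * F => p ^+ 2 +
  \sum_(z | x.2 != z) normc (\sum_y f (y, z) * paraboloid_kernel (y - x.1) (z - x.2))) _)).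
  move=> x xG.
  rewrite (eq_bigr (fun yz : V * F => f (yz.1, yz.2) * paraboloid_kernel (yz.1 - x.1) (yz.2 - x.2))); last by case.
  rewrite -(pair_bigA _ (fun y z => f (y, z) * paraboloid_kernel (y - x.1) (z - x.2))) /=.
  rewrite exchange_big (bigD1 x.2) //=.
  apply: (le_trans (le_normcD _ _)); apply: lerD.
    rewrite subrr (bigD1 x.1) //= big1 => [|y yx]; last first.
      by rewrite paraboloid_kernel0 subr_eq0 (negPf yx) mulr0.
    rewrite addr0 subrr paraboloid_kernel0 eqxx Normc.normcM normc_nat natrX.
    rewrite ler_piMl ?exprn_ge0 // (le_trans (hf _)) //.
    by case: (_ \in G).
  apply: (le_trans (normc_sum _ _ _)).
  by under eq_bigl do rewrite eq_sym.
rewrite big_split /= sumr_const mulr_natr lerD2l.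
rewrite (exchange_big_dep predT) //= mulr_sumr; apply: ler_sum => z _.
by have [_ _] := hS z.
Qed.

End Restriction.
End FourierParaboloid.

(** * Numerology of the slices *)

Section Numerics.
Variable R : realType.
Implicit Types a b c x l g r alpha : R.

(* Cheap substitute for Jensen's inequality: split according to x <= l. *)
Lemma powR_le_split x l g : 0 <= x -> 0 < l -> 0 <= g <= 1 ->
  x `^ g <= l `^ g + x * l `^ (g - 1).
Proof.
move=> x0 l0 /andP[g0 g1]; have [xl|lx] := leP x l.
  rewrite (le_trans (ge0_ler_powR g0 _ _ xl)) ?nnegrE ?(ltW l0) //.
  by rewrite lerDl mulr_ge0 ?powR_ge0.
have {}x0 : 0 < x := lt_trans l0 lx.
apply: (@le_trans _ _ (x * l `^ (g - 1))); last by rewrite lerDr powR_ge0.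
have g10 : 0 <= 1 - g by rewrite subr_ge0.
rewrite -opprB powRN ler_pdivlMr ?powR_gt0 //.
apply: (@le_trans _ _ (x `^ g * x `^ (1 - g))).
  by rewrite ler_wpM2l ?powR_ge0 ?ge0_ler_powR ?nnegrE ?(ltW l0) ?(ltW x0) ?(ltW lx).
by rewrite -powRD ?subrKC ?powRr1 ?(ltW x0) // (gt_eqF x0) implybT.
Qed.

(** The values are split at [expR (b - a)], where both parts obey the same bound. *)
Lemma sum_powR_le (I : finType) (N : I -> R) a b g :
  (forall i, 0 <= N i) -> 0 <= g <= 1 -> #|I|%:R <= expR a -> \sum_i N i = expR b ->
  \sum_i N i `^ g <= 2 * expR (a + g * (b - a)).
Proof.
move=> N0 g01 Ia Nb.
apply: (le_trans (ler_sum _ (fun i _ => powR_le_split (N0 i) (expR_gt0 (b - a)) g01))).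
rewrite big_split /= sumr_const -mulr_suml Nb -[_ *+ _]mulr_natr -!expRM -expRD.
have -> : b + (b - a) * (g - 1) = a + g * (b - a) by ring.
rewrite [a + _]addrC expRD [(b - a) * g]mulrC.
have := ler_wpM2l (expR_ge0 (g * (b - a))) Ia; lra.
Qed.

Lemma le_root4 x a b c r y : 0 <= x -> 1 <= c -> 0 <= y ->
  x ^+ 4 <= expR b ^+ 3 * (expR a ^+ 3 * (c * y `^ r)) ->
  x <= c * expR (3 / 4 * (a + b)) * y `^ (r / 4).
Proof.
move=> x0 c1 y0 h.
have c0 : 0 <= c by lra.
rewrite -(@ler_pXn2r _ 4) ?nnegrE ?mulr_ge0 ?expR_ge0 ?powR_ge0 // (le_trans h) //.
rewrite !exprMn -!expRM_natr -(powR_mulrn _ (powR_ge0 _ _)) -powRrM.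
have -> : r / 4 * 4%:R = r by field.
rewrite mulrA -expRD mulrCA mulrA.
have -> : b * 3%:R + a * 3%:R = 3 / 4 * (a + b) * 4%:R by field.
rewrite ler_wpM2r ?powR_ge0 // ler_wpM2r ?expR_ge0 //.
by rewrite -[leLHS]expr1 ler_weXn2l.
Qed.

(** Here [a] and [b] stand for the logarithms of [|F|] and [|G|], which turns comparisons of powers
    into linear inequalities; [N] gives the slice sizes and [Q] is the quantity to be bounded. *)
Lemma slices_le (I : finType) (N S : I -> R) alpha c a b Q :
  2 / 3 < alpha -> alpha <= 3 / 2 -> 1 <= c -> 0 <= a -> 0 <= b ->
  #|I|%:R <= expR a -> (forall i, 0 <= N i) -> \sum_i N i = expR b ->
  (forall i, 0 <= S i) ->
  (forall i, N i <= expR (4 * (2 - alpha) / (3 * alpha - 2) * a) ->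
    S i ^+ 4 <= expR b ^+ 3 * (expR a ^+ 3 * (c * N i `^ (1 + alpha)))) ->
  (forall i, S i ^+ 4 <= expR b ^+ 3 * (expR a ^+ 3 * (c * N i `^ (1 + 3 / 2)))) ->
  Q <= expR a ^+ 2 * expR b + expR a * expR b ^+ 2 ->
  Q <= expR a ^+ 2 * expR b + expR a * \sum_i S i ->
  Q <= (4 * c + 1) * expR a ^+ 2 * expR ((8 - alpha) / (6 - alpha) * b).
Proof.
move=> al_gt al_le c1 a0 b0 Ia N0 Nb S0 Ssmall Sall Q1 Q2.
set th := (8 - alpha) / (6 - alpha).
have al6 : 0 < 6 - alpha by lra.
have al4 : 0 < 4 - alpha by lra.
have al3 : 0 < 3 * alpha - 2 by lra.
have bth : b <= th * b.
  by rewrite ler_peMl // /th ler_pdivlMr //; lra.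
have main : expR a ^+ 2 * expR b <= expR a ^+ 2 * expR (th * b).
  by rewrite ler_wpM2l ?exprn_ge0 ?expR_ge0 // ler_expR.
have th0 : 0 <= expR a ^+ 2 * expR (th * b) by rewrite mulr_ge0 ?exprn_ge0 ?expR_ge0.
have cX (X : R) : 0 <= X -> X <= c * X by move=> X0; rewrite ler_peMl.
(* The crossover of the two methods: at equality, the Stein-Tomas term and the inequality [bigB]
   below are both sharp, which determines [th]. *)
have [ba|ba] := leP (b * (4 - alpha)) (a * (6 - alpha)).
  apply: (le_trans Q1).
  have : expR a * expR b ^+ 2 <= expR a ^+ 2 * expR (th * b).
    rewrite -!expRM_natr -!expRD ler_expR.
    suff : b * 2 <= a + th * b by lra.
    suff -> : b * 2 = b * (4 - alpha) / (6 - alpha) + th * b.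
      by rewrite lerD2r ler_pdivrMr.
    by rewrite /th; field; lra.
  have := cX _ th0; lra.
pose beta := 4 * (2 - alpha) / (3 * alpha - 2).
pose B := 2 * expR (a + (1 + alpha) / 4 * (b - a)).
pose big i := expR (beta * a) < N i.
(* Every slice is charged the incidence bound, and a big one also the trivial bound, whose exponent
   is [(1 + 3 / 2) / 4 = 5 / 8]. *)
have Sle i : S i <= c * expR (3 / 4 * (a + b)) *
    (N i `^ ((1 + alpha) / 4) + (if big i then N i `^ (5 / 8) else 0)).
  rewrite /big ltNge; case: ifPn => [h|/negPn h].
    apply: (le_trans (le_root4 (S0 i) c1 (N0 i) (Sall i))).
    rewrite (_ : (1 + 3 / 2) / 4 = 5 / 8); last by field.
    by rewrite ler_wpM2l ?mulr_ge0 ?expR_ge0 ?lerDr ?powR_ge0 //; lra.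
  by rewrite addr0; exact: le_root4 (S0 i) c1 (N0 i) (Ssmall i h).
have sumS : \sum_i S i <= c * expR (3 / 4 * (a + b)) *
    (B + \sum_i (if big i then N i `^ (5 / 8) else 0)).
  apply: (le_trans (ler_sum _ (fun i _ => Sle i))).
  rewrite -mulr_sumr big_split /= ler_wpM2l ?mulr_ge0 ?expR_ge0 ?lerD2r //; first by lra.
  by apply: sum_powR_le => //; apply/andP; split; lra.
have bigB : a + 3 / 4 * (a + b) + (a + (1 + alpha) / 4 * (b - a)) <= a * 2 + th * b.
  suff : a * (2 - alpha) <= b * ((2 - alpha) * (4 - alpha) / (6 - alpha)).
    have -> : (2 - alpha) * (4 - alpha) / (6 - alpha) = 4 * th - 4 - alpha.
      by rewrite /th; field; lra.
    by move=> h; lra.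
  have -> : b * ((2 - alpha) * (4 - alpha) / (6 - alpha)) =
    b * (4 - alpha) / (6 - alpha) * (2 - alpha) by field; lra.
  by rewrite ler_wpM2r ?ler_pdivlMr ?ltW //; lra.
have bigS : exists2 x, \sum_i (if big i then N i `^ (5 / 8) else 0) <= 2 * expR x &
    a + 3 / 4 * (a + b) + x <= a * 2 + th * b.
  (* The cases meet at [b = (1 + beta) * a]. There the two choices of [x] agree and the required
     inequality is an equality, which explains the value of [beta]. *)
  have [bs|bl] := leP (b * (3 * alpha - 2)) (a * (6 - alpha)).
    exists (b - 3 / 8 * (beta * a)).
      (* For a big slice, 5/8 is written as 1 - 3/8, and the factor with exponent -3/8 is bounded
         through the threshold. *)
      apply: (@le_trans _ _ (\sum_i N i * expR (- (3 / 8) * (beta * a)))).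
        apply: ler_sum => i _; case: ifPn => [bi|_]; last by rewrite mulr_ge0 ?expR_ge0.
        have Ni0 : 0 < N i by apply: lt_trans bi; exact: expR_gt0.
        rewrite -{1}(lnK Ni0) -expRM -{2}(lnK Ni0) -expRD ler_expR.
        suff : beta * a <= ln (N i) by lra.
        by rewrite -[leLHS]expRK ler_ln ?posrE ?expR_gt0 // ltW.
      rewrite -mulr_suml Nb -expRD mulNr.
      have := expR_ge0 (b - 3 / 8 * (beta * a)); lra.
    have uv : b / (6 - alpha) <= a / (3 * alpha - 2).
      by rewrite ler_pdivrMr // mulrAC ler_pdivlMr.
    have := ler_wpM2l (_ : 0 <= (10 - 3 * alpha) / 4) uv.
    have -> : (10 - 3 * alpha) / 4 * (b / (6 - alpha)) = b * (7 / 4) - th * b.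
      by rewrite /th; field; lra.
    have -> : (10 - 3 * alpha) / 4 * (a / (3 * alpha - 2)) = a / 4 + 3 / 8 * (beta * a).
      by rewrite /beta; field; lra.
    by move=> h; have := h ltac:(lra); lra.
  exists (a + 5 / 8 * (b - a)).
    apply: le_trans (_ : \sum_i N i `^ (5 / 8) <= _).
      by apply: ler_sum => i _; case: ifP => // _; exact: powR_ge0.
    by apply: sum_powR_le => //; apply/andP; split; lra.
  suff : a / 8 <= th * b - 11 / 8 * b by lra.
  have -> : th * b - 11 / 8 * b = b * (3 * alpha - 2) / (6 - alpha) / 8.
    by rewrite /th; field; lra.
  by rewrite ler_pM2r // ler_pdivlMr // ltW.
have [x bx hx] := bigS.
apply: (le_trans Q2).
have -> : (4 * c + 1) * expR a ^+ 2 * expR (th * b) =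
  expR a ^+ 2 * expR (th * b) + c * (2 * (expR a ^+ 2 * expR (th * b)) + 2 * (expR a ^+ 2 * expR (th * b))) by ring.
apply: lerD => //.
apply: (le_trans (ler_wpM2l (expR_ge0 a) sumS)).
rewrite -(mulrA c) mulrCA; apply: ler_wpM2l; first by lra.
rewrite [leLHS]mulrA -expRD mulrDr; apply: lerD.
  rewrite mulrCA; apply: ler_wpM2l => //.
  by rewrite -expRM_natr -!expRD ler_expR; lra.
apply: (le_trans (ler_wpM2l (expR_ge0 _) bx)).
rewrite mulrCA; apply: ler_wpM2l => //.
by rewrite -expRM_natr -!expRD ler_expR; lra.
Qed.

End Numerics.

(** * From incidences to the restriction estimate *)

Section IncidenceEnergy.
Variables (R : realType) (F : finFieldType).
Hypothesis F_aniso : forall x : F, x ^+ 2 != -1.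
Implicit Types (alpha beta K : R) (E : {set 'rV[F]_2}).

Lemma incidence_claim_trivial beta : incidence_claim F (3 / 2 : R) beta 2.
Proof.
move=> N _ P L Ll PN LN.
have := card_incidences_sqr_le Ll PN LN.
rewrite -(ler_nat R) natrX natrM natrX => h.
rewrite -(@ler_pXn2r _ 2) ?nnegrE ?mulr_ge0 ?powR_ge0 // (le_trans h) //.
rewrite exprMn -(powR_mulrn _ (powR_ge0 _ _)) -powRrM.
rewrite (_ : 3 / 2 * 2%:R = 3%:R); last by field.
by rewrite powR_mulrn // ler_wpM2r ?exprn_ge0 //; lra.
Qed.

Lemma incidence_claim_mono alpha beta beta' K K' :
  beta' <= beta -> K <= K' -> incidence_claim F alpha beta K ->
  incidence_claim F alpha beta' K'.
Proof.
move=> hb hK cl N hN P L Ll PN LN.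
apply: (@le_trans _ _ (K * N%:R `^ alpha)); last by rewrite ler_wpM2r ?powR_ge0.
apply: cl => //; apply: (le_trans hN); apply: ler_powR => //.
by rewrite ler1n; apply/card_gt0P; exists 0.
Qed.

Lemma energy_incidence_claim alpha beta K E : 0 <= K -> 0 < 1 + alpha ->
  incidence_claim F alpha beta K -> #|E|%:R <= #|F|%:R `^ beta :> R ->
  (energy E)%:R <= 2 * K * #|E|%:R `^ (1 + alpha).
Proof.
move=> K0 al0 cl hE.
apply: (@le_trans _ _ (\sum_(a in E) (#|right_angles E a|%:R : R))).
  by rewrite -natr_sum ler_nat energy_le.
apply: (@le_trans _ _ (\sum_(a in E) (2 * (K * #|E|%:R `^ alpha)))).
  apply: ler_sum => a _.
  have [L [Ll LE hL]] := card_right_angles_le F_aniso E a.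
  apply: (@le_trans _ _ (2 * #|incidences E L|%:R)); first by rewrite -natrM ler_nat.
  by rewrite ler_wpM2l //; exact: cl.
rewrite sumr_const -[leLHS]mulr_natl.
have [->|E0] := eqVneq (#|E|%:R : R) 0.
  by rewrite mul0r mulr_ge0 ?powR_ge0 // mulr_ge0.
rewrite powRD ?powRr1 ?E0 ?implybT //; lra.
Qed.

End IncidenceEnergy.

Lemma paraboloid_restriction (R : realType) (F : finFieldType) (e : F -> R[i])
    (alpha K : R) (G : {set 'rV[F]_2 * F}) (f : 'rV[F]_2 * F -> R[i]) :
  nonprincipal_additive_character e -> (forall x : F, x ^+ 2 != -1) ->
  2 / 3 < alpha -> alpha <= 3 / 2 -> 0 <= K ->
  incidence_claim F alpha (4 * (2 - alpha) / (3 * alpha - 2)) K ->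
  (forall x, Normc.normc (f x) <= (x \in G)%:R) ->
  \sum_w Normc.normc (paraboloid_transform e f w) ^+ 2 <=
  (4 * (2 * K + 4) + 1) * #|F|%:R ^+ 2 * #|G|%:R `^ ((8 - alpha) / (6 - alpha)).
Proof.
move=> he F_aniso al_gt al_le K0 cl hf.
have ST := stein_tomas he F_aniso hf.
have [S [S4 MT]] := mockenhaupt_tao he F_aniso hf.
have c0 : 0 <= 4 * (2 * K + 4) + 1 by lra.
(* Empty [G] is set apart because logarithms of [#|G|] are taken below. *)
have [m0|m0] := eqVneq #|G| 0%N.
  apply: (le_trans ST); rewrite m0 expr0n !mulr0 addr0.
  by rewrite mulr_ge0 ?powR_ge0 // mulr_ge0 ?exprn_ge0.
have p1 : 1 <= #|F|%:R :> R by rewrite ler1n; apply/card_gt0P; exists 0.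
have m1 : 1 <= #|G|%:R :> R by rewrite ler1n lt0n.
have pE : #|F|%:R = expR (ln #|F|%:R) :> R by rewrite lnK // posrE; lra.
have mE : #|G|%:R = expR (ln #|G|%:R) :> R by rewrite lnK // posrE; lra.
have a0 := ln_ge0 p1; have b0 := ln_ge0 m1.
move: ST MT S4; rewrite pE mE -expRM [ln _ * _]mulrC => ST MT S4.
(* The constant is [2 * K + 4], which dominates both energy constants: [2 * K] from the hypothesis
   and [2 * 2] from the trivial claim. *)
apply: (slices_le (N := fun z => #|slice G z|%:R) al_gt al_le _ a0 b0 _ _ _ _ _ _ ST MT).
- by lra.
- by rewrite -pE.
- by [].
- rewrite -mE -natr_sum; congr (_%:R).
  rewrite -[RHS]sum1_card [RHS]big_mkcond /=.
  rewrite (eq_bigr (fun yz => if (yz.1, yz.2) \in G then 1%N else 0%N)); last by case.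
  rewrite -(pair_bigA _ (fun y z => if (y, z) \in G then 1%N else 0%N)) exchange_big.
  apply: eq_bigr => z _; rewrite -sum1_card [LHS]big_mkcond.
  by apply: eq_bigr => y _; rewrite inE.
- by move=> z; have [] := S4 z.
- move=> z Nz; have [_ h] := S4 z; apply: (le_trans h).
  rewrite ler_wpM2l ?exprn_ge0 ?expR_ge0 // ler_wpM2l ?exprn_ge0 ?expR_ge0 //.
  apply: (le_trans (energy_incidence_claim F_aniso K0 _ cl _)); first by lra.
    by rewrite pE -expRM mulrC.
  by rewrite ler_wpM2r ?powR_ge0 //; lra.
- move=> z; have [_ h] := S4 z; apply: (le_trans h).
  rewrite ler_wpM2l ?exprn_ge0 ?expR_ge0 // ler_wpM2l ?exprn_ge0 ?expR_ge0 //.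
  have al0 : 0 < 1 + 3 / 2 :> R by lra.
  apply: (le_trans (energy_incidence_claim F_aniso (ler0n R 2) al0
    (incidence_claim_trivial (beta := 2)) _)).
    by rewrite powR_mulrn // -natrX ler_nat (leq_trans (max_card _)) // card_mx mul1n.
  by rewrite ler_wpM2r ?powR_ge0 //; lra.
Qed.

(** * From weak-type to strong-type bounds *)

Lemma powR_lt1 (R : realType) (a s : R) : 1 < a -> s < 0 -> a `^ s < 1.
Proof.
move=> a1 s0; rewrite /powR gt_eqF ?(lt_trans _ a1) // expR_lt1.
by rewrite pmulr_llt0 // ln_gt0.
Qed.

(** The level [B / 2 ^ k] contributes at most [2 ^ q * B ^ q * 2 ^ ((q0 - q) k)], and these terms
    form a convergent geometric series. *)
Lemma weak_to_strong (R : realType) (I : finType) (u : I -> R) (B q0 q : R) :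
  0 < q0 -> q0 < q -> 0 <= B -> (forall x, 0 <= u x) ->
  (forall l, 0 < l -> l `^ q0 * #|[set x | l <= u x]|%:R <= B `^ q0) ->
  \sum_x u x `^ q <= 2 `^ q / (1 - 2 `^ (q0 - q)) * B `^ q.
Proof.
move=> q00 q0q B0 u0 weak.
have q_gt0 : 0 < q := lt_trans q00 q0q.
(* A nonempty level set has counting measure at least 1, so the weak bound caps [u] at [B] and the
   dyadic levels can start there. *)
have uB x : u x <= B.
  have [->//|ux0] := eqVneq (u x) 0.
  have {}ux0 : 0 < u x by rewrite lt_neqAle eq_sym ux0 u0.
  rewrite leNgt; apply/negP => Bu.
  have := gt0_ltr_powR q00 B0 (u0 x) Bu; rewrite ltNge => /negP; apply.
  apply: le_trans (weak _ ux0); rewrite ler_peMr ?powR_ge0 //.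
  by rewrite ler1n; apply/card_gt0P; exists x; rewrite inE.
have rho1 : 2 `^ (q0 - q) < 1 :> R.
  by apply: powR_lt1; rewrite ?ltr1n // subr_lt0.
have rho0 : 0 < 2 `^ (q0 - q) :> R by exact: powR_gt0.
have D0 : 0 <= 2 `^ q / (1 - 2 `^ (q0 - q)) :> R.
  by rewrite divr_ge0 ?powR_ge0 // subr_ge0 ltW.
have [Bz|Bnz] := eqVneq B 0.
  rewrite big1 => [|x _]; first by rewrite mulr_ge0 ?powR_ge0.
  have -> : u x = 0 by apply/eqP; rewrite eq_le u0 -Bz uB.
  by rewrite powR0 // gt_eqF.
have {B0 Bnz} B0 : 0 < B by rewrite lt_neqAle eq_sym Bnz B0.
pose l k : R := B * (2^-1) ^+ k.
have l0 k : 0 < l k by rewrite mulr_gt0 // exprn_gt0 // invr_gt0.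
(* The single level with [l k <= u x < 2 * l k] already suffices; the induction locates it. *)
have dyadic n x : 2 * l n <= u x ->
    u x `^ q <= \sum_(k < n) (2 * l k) `^ q * (l k <= u x)%R%:R.
  elim: n => [|n IH] un.
    by have := uB x; move: un; rewrite /l expr0 mulr1; lra.
  rewrite big_ord_recr /=; have [/IH h|un'] := leP (2 * l n) (u x).
    by apply: (le_trans h); rewrite lerDl mulr_ge0 ?powR_ge0.
  have -> : l n <= u x by move: un; rewrite /l exprS; lra.
  rewrite mulr1; apply: (@le_trans _ _ ((2 * l n) `^ q)).
    by apply: ge0_ler_powR; rewrite ?nnegrE ?u0 ?(ltW un') ?(ltW q_gt0) ?mulr_ge0 ?(ltW (l0 n)) // ltW.
  by rewrite lerDr; apply: sumr_ge0 => k _; rewrite mulr_ge0 ?powR_ge0.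
(* As [I] is finite, one depth [n] serves all points where [u] is nonzero. *)
have [n hn] : exists n, forall x, u x = 0 \/ 2 * l n <= u x.
  have hn x : exists n, u x = 0 \/ 2 * l n <= u x.
    have [->|ux0] := eqVneq (u x) 0; first by exists 0%N; left.
    have {}ux0 : 0 < u x by rewrite lt_neqAle eq_sym ux0 u0.
    exists (Num.bound (2 * B / u x)); right; set n := Num.bound _.
    rewrite /l exprVn mulrA ler_pdivrMr ?exprn_gt0 // [leRHS]mulrC -ler_pdivrMr //.
    have h : 2 * B / u x < n%:R by apply: archi_boundP; rewrite divr_ge0 ?mulr_ge0 // ltW.
    by rewrite (le_trans (ltW h)) // -natrX ler_nat ltnW // ltn_expl.
  have [n_ hn_] := choice hn.
  exists (\max_x n_ x)%N => x; have [->|h] := hn_ x; [by left|right].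
  apply: le_trans h; rewrite ler_wpM2l // ler_wpM2l ?(ltW B0) //.
  by apply: ler_wiXn2l; rewrite ?leq_bigmax ?invr_ge0 ?invf_le1 // ler1n.
apply: (@le_trans _ _ (\sum_x \sum_(k < n) (2 * l k) `^ q * (l k <= u x)%R%:R)).
  apply: ler_sum => x _; have [->|/dyadic//] := hn x.
  rewrite powR0 ?gt_eqF //; apply: sumr_ge0 => k _.
  by rewrite mulr_ge0 ?powR_ge0.
rewrite exchange_big /=.
apply: (@le_trans _ _ (\sum_(k < n) 2 `^ q * B `^ q * (2 `^ (q0 - q)) ^+ k)).
  apply: ler_sum => k _; rewrite -mulr_sumr -natr_sum.
  have -> : (\sum_x (l k <= u x)%R = #|[set x | (l k <= u x)%R]|)%N.
    by rewrite -sum1dep_card [RHS]big_mkcond; apply: eq_bigr => x _; case: (_ <= _).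
  have -> : (2 * l k) `^ q = 2 `^ q * l k `^ (q - q0) * l k `^ q0.
    by rewrite powRM ?ltW // -mulrA -powRD ?subrK // gt_eqF ?l0 ?implybT.
  rewrite -mulrA; apply: (@le_trans _ _ (2 `^ q * l k `^ (q - q0) * B `^ q0)).
    by rewrite ler_wpM2l ?mulr_ge0 ?powR_ge0 ?weak.
  rewrite /l powRM ?exprn_ge0 ?(ltW B0) ?invr_ge0 //.
  have -> : (2^-1 ^+ k) `^ (q - q0) = (2 `^ (q0 - q)) ^+ k :> R.
    rewrite -(powR_inv1 (ler0n R 2)) -!(powR_mulrn k (powR_ge0 _ _)) -!powRrM.
    by congr (_ `^ _); ring.
  have -> : B `^ q = B `^ (q - q0) * B `^ q0 by rewrite -powRD ?subrK // gt_eqF ?implybT.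
  rewrite le_eqVlt; apply/orP; left; apply/eqP; ring.
rewrite -mulr_sumr [leRHS]mulrAC; apply: ler_wpM2l; first by rewrite mulr_ge0 ?powR_ge0.
rewrite -[leRHS]div1r ler_pdivlMr ?subr_gt0 // mulrC -[1 - _]opprB mulNr -subrX1 opprB.
by rewrite lerBlDr lerDl exprn_ge0 ?powR_ge0.
Qed.

(** * The extension operator *)

Section Extension.
Variables (R : realType) (F : finFieldType) (e : F -> R[i]).
Hypothesis he : nonprincipal_additive_character e.
Local Notation normc := (@Normc.normc R).
Local Notation V := 'rV[F]_2.
Local Notation p := (#|F|%:R : R).

Definition coord3 (x : V * F) : 'rV[F]_3 := (row_mx x.1 (\row_(_ < 1) x.2) : 'rV[F]_(2 + 1)).

Lemma coord3_bij : bijective coord3.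
Proof.
exists (fun x : 'rV[F]_(2 + 1) => (lsubmx x, rsubmx x 0 0)) => [[y z]|x].
  by rewrite /coord3 row_mxKl row_mxKr mxE.
rewrite /coord3 /= -[RHS]hsubmxK; congr row_mx.
by apply/rowP => i; rewrite mxE ord1.
Qed.

Lemma dotv_coord3 x y : dotv (coord3 x) (coord3 y) = dotv x.1 y.1 + x.2 * y.2.
Proof.
rewrite /dotv /coord3 -[3%N]/(2 + 1)%N big_split_ord /= big_ord1; congr (_ + _).
  by apply: eq_bigr => i _; rewrite !row_mxEl.
by rewrite !row_mxEr !mxE.
Qed.

Definition lift_paraboloid (w : V) := coord3 (w, dotv w w).

Lemma lift_paraboloid_inj : injective lift_paraboloid.
Proof. by move=> v w /(bij_inj coord3_bij)[]. Qed.

Lemma card_paraboloid : #|paraboloid F| = (#|F| ^ 2)%N.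
Proof. by rewrite card_imset ?card_mx ?mul1n //; exact: lift_paraboloid_inj. Qed.

Lemma sum_paraboloid (T : nmodType) (h : 'rV[F]_3 -> T) :
  \sum_(xi in paraboloid F) h xi = \sum_w h (lift_paraboloid w).
Proof.
by rewrite big_imset //= => v w _ _; exact: lift_paraboloid_inj.
Qed.

Lemma pairing_extension (f : V * F -> R[i]) (g : 'rV[F]_3 -> R[i]) :
  \sum_x f x * extension e (paraboloid F) g (coord3 x) =
  #|paraboloid F|%:R^-1 * \sum_w g (lift_paraboloid w) * paraboloid_transform e f w.
Proof.
rewrite /extension /paraboloid_transform.
under eq_bigr do rewrite sum_paraboloid mulrCA mulr_sumr.
rewrite -mulr_sumr exchange_big; congr (_ * _); apply: eq_bigr => w _.
rewrite mulr_sumr; apply: eq_bigr => x _; rewrite mulrCA; congr (_ * (_ * e _)).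
by rewrite dotv_coord3 /= dotvC [_ * dotv w w]mulrC.
Qed.

Lemma norm_surface2E (S : {set 'rV[F]_3}) (g : 'rV[F]_3 -> R[i]) :
  norm_surface S 2 g = (#|S|%:R^-1 * \sum_(xi in S) normc (g xi) ^+ 2) `^ 2^-1.
Proof.
by congr ((_ * _) `^ _); apply: eq_bigr => xi _; rewrite powR_mulrn ?normc_ge0.
Qed.

(** Duality: the extension is tested against its own conjugate phase on the level set [G]. With
    [m = #|G|] and [A] the squared norm of [g], this yields [(l * m) ^+ 2 <= D * A * m ^ th], which
    is then solved for [m]. *)
Lemma extension_weak_type (D th l : R) (g : 'rV[F]_3 -> R[i]) :
  0 <= D -> th < 2 -> 0 < l ->
  (forall (G : {set V * F}) f, (forall x, normc (f x) <= (x \in G)%:R) ->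
    \sum_w normc (paraboloid_transform e f w) ^+ 2 <= D * p ^+ 2 * #|G|%:R `^ th) ->
  l `^ (2 / (2 - th)) *
    #|[set x | l <= normc (extension e (paraboloid F) g (coord3 x))]|%:R <=
  (D `^ 2^-1 * norm_surface (paraboloid F) 2 g) `^ (2 / (2 - th)).
Proof.
move=> D0 th2 l0 hQ.
set h := fun x => extension e (paraboloid F) g (coord3 x).
set G := [set x | _]; set m : R := #|G|%:R.
set A := #|paraboloid F|%:R^-1 * \sum_(xi in paraboloid F) normc (g xi) ^+ 2.
have A0 : 0 <= A.
  by rewrite mulr_ge0 ?invr_ge0 // sumr_ge0 // => x _; rewrite exprn_ge0 ?normc_ge0.
rewrite norm_surface2E -/A -powRM // -powRrM.
have [m0|m0] := eqVneq m 0; first by rewrite m0 mulr0 powR_ge0.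
have m_gt0 : 0 < m by rewrite lt_neqAle eq_sym m0 ler0n.
have p0 : 0 < p by rewrite ltr0n; apply/card_gt0P; exists 0.
pose f x : R[i] := if x \in G then conjc (h x) * ((normc (h x))^-1)%:C else 0.
have fh x : f x * h x = (if x \in G then normc (h x) else 0)%:C.
  rewrite /f; case: ifP => [|_]; last by rewrite mul0r.
  rewrite inE -/(h x) => lh; have hx0 : normc (h x) != 0 by rewrite gt_eqF // (lt_le_trans l0).
  by rewrite mulrAC [_ * h x]mulrC -sqr_normc_conj -realCM expr2 mulfK.
have hf x : normc (f x) <= (x \in G)%:R.
  rewrite /f; case: ifP => [|_]; last by rewrite Normc.normc0.
  rewrite inE -/(h x) => lh; have hx0 : 0 < normc (h x) := lt_le_trans l0 lh.
  by rewrite Normc.normcM normc_conj normc_real ger0_norm ?invr_ge0 ?(ltW hx0) // mulfV ?gt_eqF.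
have lm : l * m <= #|paraboloid F|%:R^-1 *
    \sum_w normc (g (lift_paraboloid w)) * normc (paraboloid_transform e f w).
  have E := congr1 normc (pairing_extension f g).
  rewrite (eq_bigr _ (fun x _ => fh x)) -realC_sum normc_real in E.
  apply: (@le_trans _ _ (\sum_x (if x \in G then normc (h x) else 0))).
    rewrite /m -sum1_card natr_sum mulr_sumr [leLHS]big_mkcond /=.
    by apply: ler_sum => x _; case: ifP => //; rewrite inE mulr1.
  apply: (le_trans (ler_norm _)); rewrite E Normc.normcM.
  have -> : normc (#|paraboloid F|%:R^-1) = #|paraboloid F|%:R^-1.
    by rewrite Normc.normcV normc_nat.
  rewrite ler_wpM2l ?invr_ge0 // (le_trans (normc_sum _ _ _)) //.
  by apply: ler_sum => w _; rewrite Normc.normcM.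
have lm2 : (l * m) ^+ 2 <= D * A * m `^ th.
  apply: (@le_trans _ _ ((#|paraboloid F|%:R^-1 *
    \sum_w normc (g (lift_paraboloid w)) * normc (paraboloid_transform e f w)) ^+ 2)).
    by rewrite lerXn2r ?nnegrE ?mulr_ge0 ?invr_ge0 ?(ltW l0) ?sumr_ge0 // => w _; rewrite mulr_ge0 ?normc_ge0.
  rewrite exprMn; apply: (le_trans (ler_wpM2l _ (sum_cauchy_schwarz _ _ _))).
    by rewrite exprn_ge0 ?invr_ge0.
  have h0 := hQ G f hf.
  apply: (le_trans (ler_wpM2l _ (ler_wpM2l _ h0))); rewrite ?exprn_ge0 ?invr_ge0 //.
    by apply: sumr_ge0 => w _; rewrite exprn_ge0 ?normc_ge0.
  rewrite /A sum_paraboloid card_paraboloid natrX -/m le_eqVlt; apply/orP; left; apply/eqP.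
  field; exact: lt0r_neq0.
have th20 : 0 < 2 - th by rewrite subr_gt0.
have lm3 : l ^+ 2 * m `^ (2 - th) <= D * A.
  rewrite powRB ?m0 ?implybT // mulrA ler_pdivrMr ?powR_gt0 //.
  by rewrite powR_mulrn ?ler0n // -exprMn.
have H : (l ^+ 2 * m `^ (2 - th)) `^ (2 - th)^-1 <= (D * A) `^ (2 - th)^-1.
  apply: (ge0_ler_powR _ _ _ lm3); rewrite ?nnegrE.
  - by rewrite invr_ge0 ltW.
  - by rewrite mulr_ge0 ?powR_ge0 ?sqr_ge0.
  - exact: mulr_ge0.
have -> : 2^-1 * (2 / (2 - th)) = (2 - th)^-1 by field; rewrite gt_eqF.
apply: le_trans H.
rewrite powRM ?exprn_ge0 ?powR_ge0 ?(ltW l0) // -(powR_mulrn 2 (ltW l0)) -!powRrM.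
by rewrite divff ?gt_eqF // powRr1 // ltW.
Qed.

Lemma extension_strong_type (D th q : R) (g : 'rV[F]_3 -> R[i]) :
  0 <= D -> th < 2 -> 2 / (2 - th) < q ->
  (forall (G : {set V * F}) f, (forall x, normc (f x) <= (x \in G)%:R) ->
    \sum_w normc (paraboloid_transform e f w) ^+ 2 <= D * p ^+ 2 * #|G|%:R `^ th) ->
  norm_counting q (extension e (paraboloid F) g) <=
  (2 `^ q / (1 - 2 `^ (2 / (2 - th) - q))) `^ q^-1 * D `^ 2^-1 *
    norm_surface (paraboloid F) 2 g.
Proof.
move=> D0 th2 hq hQ.
set B := D `^ 2^-1 * norm_surface (paraboloid F) 2 g.
have B0 : 0 <= B by rewrite mulr_ge0 ?powR_ge0.
have q00 : 0 < 2 / (2 - th) by rewrite divr_gt0 ?subr_gt0.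
have q0 : 0 < q := lt_trans q00 hq.
have := weak_to_strong q00 hq B0 (fun x => normc_ge0 _)
  (fun l l0 => extension_weak_type g D0 th2 l0 hQ).
set X := \sum_x _ => hX; rewrite -mulrA -/B.
have -> : norm_counting q (extension e (paraboloid F) g) = X `^ q^-1.
  by congr (_ `^ _); rewrite (reindex coord3) //; apply: onW_bij; exact: coord3_bij.
have X0 : 0 <= X by apply: sumr_ge0 => x _; exact: powR_ge0.
apply: (le_trans (ge0_ler_powR _ _ _ hX)); rewrite ?nnegrE ?invr_ge0 ?(ltW q0) //.
  exact: le_trans hX.
rewrite powRM ?powR_ge0 //; last first.
  by rewrite divr_ge0 ?powR_ge0 // subr_ge0 ltW // powR_lt1 ?ltr1n // subr_lt0.
by rewrite -powRrM divff ?gt_eqF // powRr1.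
Qed.

End Extension.

Unset Implicit Arguments.

(** Uniformity in the field is expressed by choosing [C] before [F] and [e], from [alpha], [K] and
    [eps] alone. The bounds on [alpha] make both denominators positive. *)
Theorem theorem2 (R : realType) (alpha K eps : R)
    (alpha_gt : 2 / 3 < alpha) (alpha_lt : alpha < 4) (eps_gt0 : 0 < eps) :
  exists C : R, forall (F : finFieldType) (e : F -> R[i]),
    prime #|F| ->
    (forall x : F, x ^+ 2 != -1) ->
    nonprincipal_additive_character e ->
    incidence_claim F alpha
      (8 * (alpha - 3) * (alpha - 2) / (9 * alpha - 6)) K ->
    (extension_constant e (paraboloid F) 2
       ((12 - 2 * alpha) / (4 - alpha) + eps) <= C%:E)%E.
Proof.
set q := _ / _ + _.
pose al := Num.min alpha (3 / 2).
(* Nonnegative, and at least both [K] and the constant 2 of the trivial incidence bound. *)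
pose K' : R := `|K| + 2.
pose D : R := 4 * (2 * K' + 4) + 1.
pose th := (8 - al) / (6 - al).
exists ((2 `^ q / (1 - 2 `^ (2 / (2 - th) - q))) `^ q^-1 * D `^ 2^-1).
move=> F e _ F_aniso he cl.
have K'0 : 0 <= K' by rewrite addr_ge0.
have D0 : 0 <= D by rewrite /D; lra.
have al_le : al <= 3 / 2 by rewrite /al ge_min lexx orbT.
have al_le' : al <= alpha by rewrite /al ge_min lexx.
have al_gt : 2 / 3 < al by rewrite /al lt_min alpha_gt /=; lra.
have th2 : th < 2 by rewrite /th ltr_pdivrMr; lra.
have thE : 2 / (2 - th) = 2 + 4 / (4 - al).
  by rewrite /th; field; apply/andP; split; lra.
have qE : q = 2 + 4 / (4 - alpha) + eps by rewrite /q; field; lra.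
have hq : 2 / (2 - th) < q.
  rewrite thE qE.
  (* The critical exponent increases with [alpha], so passing to the smaller [al] is harmless. *)
  suff : 4 / (4 - al) <= 4 / (4 - alpha) by lra.
  by rewrite ler_pM2l // lef_pV2 ?posrE; lra.
have cl' : incidence_claim F al (4 * (2 - al) / (3 * al - 2)) K'.
  rewrite /al; case: leP => h; last first.
    by apply: incidence_claim_mono (@incidence_claim_trivial R F _); rewrite // /K' lerDr.
  apply: incidence_claim_mono cl; last by rewrite /K' (le_trans (ler_norm K)) // lerDl.
  (* For [alpha <= 3 / 2] one has [8 / 3 * (3 - alpha) >= 4], so the assumed range of [N] contains
     the one needed for the slices. *)
  rewrite ler_pdivrMr; last by lra.
  have -> : 8 * (alpha - 3) * (alpha - 2) / (9 * alpha - 6) * (3 * alpha - 2) =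
    8 / 3 * (3 - alpha) * (2 - alpha) by field; lra.
  by rewrite ler_wpM2r; lra.
apply: ereal_inf_lbound; exists ((2 `^ q / (1 - 2 `^ (2 / (2 - th) - q))) `^ q^-1 * D `^ 2^-1) => //=.
split=> [|g _]; first by rewrite mulr_ge0 ?powR_ge0.
apply: extension_strong_type => // G f hf.
exact: paraboloid_restriction.
Qed.
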